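(* Isoclinism of crossed modules is an equivalence relation (reflexive, symmetric and transitive) on the class of crossed modules.
   Context: A crossed module $G:G_1\overset{d_G}{\longrightarrow}G_0$ is a group homomorphism $d_G:G_1\to G_0$ together with a left action of $G_0$ on $G_1$ by automorphisms, written ${}^{g_0}g_1$, such that $d_G({}^{g_0}g_1)=g_0d_G(g_1)g_0^{-1}$ and ${}^{d_G(g_1)}g_1'=g_1g_1'g_1^{-1}$. A morphism from $G$ to $G':G_1'\overset{d'}{\longrightarrow}G_0'$ is a pair $(\alpha,\beta)$ of group homomorphisms $\alpha:G_1\to G_1'$, $\beta:G_0\to G_0'$ with $\beta d_G=d'\alpha$ and $\alpha({}^{g_0}g_1)={}^{\beta(g_0)}\alpha(g_1)$; it is an isomorphism if both components are bijective. Put $G_1^{G_0}=\{g_1\in G_1:{}^{g_0}g_1=g_1\ \forall g_0\in G_0\}$, $St_{G_0}(G_1)=\{g_0\in G_0:{}^{g_0}g_1=g_1\ \forall g_1\in G_1\}$, and let $D_{G_0}(G_1)$ be the subgroup of $G_1$ generated by all ${}^{g_0}g_1g_1^{-1}$. The center of $G$ is $Z(G):G_1^{G_0}\to St_{G_0}(G_1)\cap Z(G_0)$ and the commutator subcrossed module is $[G,G]:D_{G_0}(G_1)\to[G_0,G_0]$ (maps and actions restricted from $G$). The quotient $G/Z(G)$ is the crossed module $\overline{G_1}\to\overline{G_0}$ with induced map and action, where $\overline{G_1}=G_1/G_1^{G_0}$, $\overline{G_0}=G_0/(St_{G_0}(G_1)\cap Z(G_0))$. There are well-defined maps $c_1^G:\overline{G_1}\times\overline{G_0}\to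 D_{G_0}(G_1)$, $(\overline{g_1},\overline{g_0})\mapsto{}^{g_0}g_1g_1^{-1}$, and $c_0^G:\overline{G_0}\times\overline{G_0}\to[G_0,G_0]$, $(\overline{g_0},\overline{g_0'})\mapsto[g_0,g_0']=g_0g_0'g_0^{-1}g_0'^{-1}$. Crossed modules $G$ and $H$ are isoclinic if there exist crossed module isomorphisms $(\eta_1,\eta_0):G/Z(G)\to H/Z(H)$ and $(\xi_1,\xi_0):[G,G]\to[H,H]$ such that $\xi_1\circ c_1^G=c_1^H\circ(\eta_1\times\eta_0)$ and $\xi_0\circ c_0^G=c_0^H\circ(\eta_0\times\eta_0)$. *)

(* Defs.v *)
From HB Require Import structures.
From mathcomp Require Import all_boot boolp.

Set Implicit Arguments.
Unset Strict Implicit.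
Unset Printing Implicit Defensive.

Local Open Scope group_scope.
Local Open Scope quotient_scope.

(* Groups are arbitrary, possibly infinite, [groupType]s.
   [groupType] includes a choice structure, which every type carries
   classically ([boolp]), so this is no restriction. *)

Notation groupHom := UMagmaMorphism.type.

Definition subgroup_type (G : groupType) (S : groupClosed G) : Type :=
  {x : G | x \in S}.

Section SubgroupType.
Variables (G : groupType) (S : groupClosed G).

HB.instance Definition _ := SubChoice.on (subgroup_type S).

Fact subgroup_type_closed : group_closed (fun x : G => x \in S).
Proof. by split; [exact: gpred1 | exact: (@gpredF G S)]. Qed.

HB.instance Definition _ :=
  SubChoice_isSubGroup.Build G (fun x : G => x \in S) (subgroup_type S)
    subgroup_type_closed.

Definition subgroup_elt (x : G) (xS : x \in S) : subgroup_type S := exist _ x xS.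

End SubgroupType.

Definition generated (G : groupType) (A : G -> Prop) : {pred G} :=
  fun x => `[< forall S : groupClosed G, (forall a, A a -> a \in S) -> x \in S >].

Section Generated.
Variables (G : groupType) (A : G -> Prop).

Lemma generatedP (x : G) :
  reflect (forall S : groupClosed G, (forall a, A a -> a \in S) -> x \in S)
          (x \in generated A).
Proof. exact: asboolP. Qed.

Lemma mem_generated (a : G) : A a -> a \in generated A.
Proof. by move=> Aa; apply/generatedP => S; apply. Qed.

Fact generatedM : mulg_closed (generated A).
Proof.
move=> x y /generatedP xA /generatedP yA; apply/generatedP => S AS.
by rewrite gpredM ?xA ?yA.
Qed.

Fact generated1 : 1 \in generated A.
Proof. by apply/generatedP => S _; exact: gpred1. Qed.

Fact generatedV : invg_closed (generated A).
Proof.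
by move=> x /generatedP xA; apply/generatedP => S AS; rewrite gpredV xA.
Qed.

HB.instance Definition _ := isMulClosed.Build G (generated A) generatedM.
HB.instance Definition _ := isMul1Closed.Build G (generated A) generated1.
HB.instance Definition _ := isInvClosed.Build G (generated A) generatedV.

End Generated.

(* The library's [~ x, y] is x^-1 * y^-1 * x * y; this is the other
   convention. *)
Definition comm (G : groupType) (x y : G) : G := x * y * x^-1 * y^-1.

Definition derived (G : groupType) : groupClosed G :=
  generated (fun z : G => exists x y : G, z = comm x y).

Lemma mem_derived (G : groupType) (x y : G) : comm x y \in derived G.
Proof. by apply: mem_generated; exists x, y. Qed.

Record normalSubgroup (G : groupType) := NormalSubgroup {
  nsub :> groupClosed G;
  nsubJ : forall g n : G, n \in nsub -> g * n * g^-1 \in nsub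
}.

Section Quotient.
Variables (G : groupType) (N : normalSubgroup G).

Definition coset_rel : rel G := fun x y => x^-1 * y \in (N : groupClosed G).

Fact coset_rel_refl : reflexive coset_rel.
Proof. by move=> x; rewrite /coset_rel mulVg gpred1. Qed.

Fact coset_rel_sym : symmetric coset_rel.
Proof. by move=> x y; rewrite /coset_rel -gpredV invgM invgK. Qed.

Fact coset_rel_trans : transitive coset_rel.
Proof.
move=> y x z xy yz; rewrite /coset_rel.
have -> : x^-1 * z = (x^-1 * y) * (y^-1 * z) by rewrite mulgA mulgK.
exact: gpredM.
Qed.

Canonical coset_equiv_rel :=
  EquivRel coset_rel coset_rel_refl coset_rel_sym coset_rel_trans.

Definition quotient_group : Type := {eq_quot coset_rel}.

HB.instance Definition _ := Choice.on quotient_group.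
HB.instance Definition _ := Quotient.on quotient_group.

Definition coset (x : G) : quotient_group := \pi_quotient_group x.

Lemma cosetP (x y : G) :
  reflect (coset x = coset y) (x^-1 * y \in (N : groupClosed G)).
Proof. exact: (@eqmodP G coset_equiv_rel). Qed.

Lemma coset_repr (q : quotient_group) : coset (repr q) = q.
Proof. exact: reprK. Qed.

Lemma repr_coset (x : G) :
  exists2 n, n \in (N : groupClosed G) & repr (coset x) = x * n.
Proof.
exists (x^-1 * repr (coset x)); last by rewrite mulVKg.
by apply/cosetP; rewrite coset_repr.
Qed.

Definition quotient_mul (p q : quotient_group) := coset (repr p * repr q).
Definition quotient_one := coset 1.
Definition quotient_inv (p : quotient_group) := coset (repr p)^-1.

Lemma quotient_mulE (x y : G) :
  quotient_mul (coset x) (coset y) = coset (x * y).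
Proof.
rewrite /quotient_mul; have [m mN ->] := repr_coset x.
have [n nN ->] := repr_coset y; apply/esym/cosetP.
have -> : (x * y)^-1 * (x * m * (y * n)) = (y^-1 * m * y^-1^-1) * n.
  by rewrite invgM invgK !mulgA mulgVK.
by rewrite gpredM // nsubJ.
Qed.

Lemma quotient_invE (x : G) : quotient_inv (coset x) = coset x^-1.
Proof.
rewrite /quotient_inv; have [n nN ->] := repr_coset x; apply/esym/cosetP.
by rewrite invgK invgM mulgA nsubJ // gpredV.
Qed.

Fact quotient_mulA : associative quotient_mul.
Proof.
move=> p q r; rewrite -(coset_repr p) -(coset_repr q) -(coset_repr r).
by rewrite !quotient_mulE mulgA.
Qed.

Fact quotient_mul1q : left_id quotient_one quotient_mul.
Proof. by move=> p; rewrite -(coset_repr p) quotient_mulE mul1g. Qed.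

Fact quotient_mulq1 : right_id quotient_one quotient_mul.
Proof. by move=> p; rewrite -(coset_repr p) quotient_mulE mulg1. Qed.

Fact quotient_mulVq : left_inverse quotient_one quotient_inv quotient_mul.
Proof.
by move=> p; rewrite -(coset_repr p) quotient_invE quotient_mulE mulVg.
Qed.

Fact quotient_mulqV : right_inverse quotient_one quotient_inv quotient_mul.
Proof.
by move=> p; rewrite -(coset_repr p) quotient_invE quotient_mulE mulgV.
Qed.

HB.instance Definition _ := isGroup.Build quotient_group
  quotient_mulA quotient_mul1q quotient_mulq1 quotient_mulVq quotient_mulqV.

Lemma cosetM (x y : G) : coset (x * y) = coset x * coset y.
Proof. exact/esym/quotient_mulE. Qed.

Lemma coset1 : coset 1 = 1.
Proof. by []. Qed.

Lemma cosetV (x : G) : coset x^-1 = (coset x)^-1.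
Proof. exact/esym/quotient_invE. Qed.

Lemma coset_ind (P : quotient_group -> Prop) :
  (forall x, P (coset x)) -> forall q, P q.
Proof. by move=> IH q; rewrite -(coset_repr q). Qed.

End Quotient.

Record crossedModule := CrossedModule {
  xm1 : groupType;
  xm0 : groupType;
  xd : groupHom xm1 xm0;
  xact : xm0 -> xm1 -> xm1;
  xact1 : forall x, xact 1 x = x;
  xactM : forall g h x, xact (g * h) x = xact g (xact h x);
  xact_mul : forall g x y, xact g (x * y) = xact g x * xact g y;
  xd_act : forall g x, xd (xact g x) = g * xd x * g^-1;
  xact_d : forall x y, xact (xd x) y = x * y * x^-1
}.

Record xmodHom (G H : crossedModule) := XmodHom {
  hom1 : groupHom (xm1 G) (xm1 H);
  hom0 : groupHom (xm0 G) (xm0 H);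
  hom_d : forall x, hom0 (xd G x) = xd H (hom1 x);
  hom_act : forall g x, hom1 (xact g x) = xact (hom0 g) (hom1 x)
}.

Definition is_xmod_iso (G H : crossedModule) (f : xmodHom G H) : Prop :=
  bijective (hom1 f) /\ bijective (hom0 f).

Lemma hom_inv (G H : groupType) (f : groupHom G H) x : f x^-1 = (f x)^-1.
Proof. by apply: (mulgI (f x)); rewrite -gmulfM !mulgV gmulf1. Qed.

Lemma xact_one (G : crossedModule) (g : xm0 G) : xact g 1 = 1 :> xm1 G.
Proof. by apply: (mulgI (xact g 1)); rewrite -xact_mul !mulg1. Qed.

Lemma xact_inv (G : crossedModule) (g : xm0 G) (x : xm1 G) :
  xact g x^-1 = (xact g x)^-1.
Proof. by apply: (mulgI (xact g x)); rewrite -xact_mul !mulgV xact_one. Qed.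

Record subXmod (G : crossedModule) := SubXmod {
  sub1 : groupClosed (xm1 G);
  sub0 : groupClosed (xm0 G);
  sub_d : forall x, x \in sub1 -> xd G x \in sub0;
  sub_act : forall g x, g \in sub0 -> x \in sub1 -> xact g x \in sub1
}.

Section SubCrossedModule.
Variables (G : crossedModule) (S : subXmod G).
Local Notation S1 := (subgroup_type (sub1 S)).
Local Notation S0 := (subgroup_type (sub0 S)).

Definition sub_xd (x : S1) : S0 := subgroup_elt (sub_d (valP x)).
Definition sub_xact (g : S0) (x : S1) : S1 :=
  subgroup_elt (sub_act (valP g) (valP x)).

Fact sub_xd_hom : monoid_morphism sub_xd.
Proof.
by split=> [|x y]; apply: val_inj; rewrite /= ?gmulf1 ?gmulfM.
Qed.
HB.instance Definition _ := isUMagmaMorphism.Build S1 S0 sub_xd sub_xd_hom.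

Definition xmod_of_sub : crossedModule.
Proof.
refine (@CrossedModule S1 S0 sub_xd sub_xact _ _ _ _ _).
- by move=> x; apply: val_inj; rewrite /= xact1.
- by move=> g h x; apply: val_inj; rewrite /= xactM.
- by move=> g x y; apply: val_inj; rewrite /= xact_mul.
- by move=> g x; apply: val_inj; rewrite /= xd_act.
- by move=> x y; apply: val_inj; rewrite /= xact_d.
Defined.

End SubCrossedModule.

(* Normality of the first component in xm1 follows, by [xact_d]. *)
Record normalSubXmod (G : crossedModule) := NormalSubXmod {
  nsubX :> subXmod G;
  nsub0J : forall g n, n \in sub0 nsubX -> g * n * g^-1 \in sub0 nsubX;
  nsub1_act : forall g x, x \in sub1 nsubX -> xact g x \in sub1 nsubX;
  nsub0_act : forall n x, n \in sub0 nsubX -> xact n x * x^-1 \in sub1 nsubX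
}.

Section QuotientCrossedModule.
Variables (G : crossedModule) (N : normalSubXmod G).

Fact nsub1J (x n : xm1 G) : n \in sub1 N -> x * n * x^-1 \in sub1 N.
Proof. by rewrite -xact_d; exact: nsub1_act. Qed.

Definition nsub1 : normalSubgroup (xm1 G) := NormalSubgroup nsub1J.
Definition nsub0 : normalSubgroup (xm0 G) := NormalSubgroup (@nsub0J G N).

Local Notation Q1 := (quotient_group nsub1).
Local Notation Q0 := (quotient_group nsub0).

Definition quo_xd (p : Q1) : Q0 := coset nsub0 (xd G (repr p)).
Definition quo_xact (q : Q0) (p : Q1) : Q1 :=
  coset nsub1 (xact (repr q) (repr p)).

Lemma quo_xdE (x : xm1 G) : quo_xd (coset nsub1 x) = coset nsub0 (xd G x).
Proof.
rewrite /quo_xd; have [n nN ->] := repr_coset nsub1 x; apply/esym/cosetP.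
by rewrite gmulfM mulKg; exact: sub_d.
Qed.

Lemma quo_xactE (g : xm0 G) (x : xm1 G) :
  quo_xact (coset nsub0 g) (coset nsub1 x) = coset nsub1 (xact g x).
Proof.
rewrite /quo_xact; have [n nN ->] := repr_coset nsub1 x.
have [m mN ->] := repr_coset nsub0 g; apply/esym/cosetP.
rewrite xactM -xact_inv -xact_mul; apply: nsub1_act.
rewrite xact_mul mulgA gpredM //; last exact: nsub1_act.
by have := nsub1J x^-1 (nsub0_act x mN); rewrite invgK !mulgA mulgVK.
Qed.

Fact quo_xd_hom : monoid_morphism quo_xd.
Proof.
split=> [|p q]; first by rewrite -!coset1 quo_xdE gmulf1.
elim/coset_ind: p => x; elim/coset_ind: q => y.
by rewrite -cosetM !quo_xdE gmulfM cosetM.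
Qed.
HB.instance Definition _ := isUMagmaMorphism.Build Q1 Q0 quo_xd quo_xd_hom.

Definition quotient_xmod : crossedModule.
Proof.
refine (@CrossedModule Q1 Q0 quo_xd quo_xact _ _ _ _ _).
- by elim/coset_ind=> x; rewrite -coset1 quo_xactE xact1.
- elim/coset_ind=> g; elim/coset_ind=> h; elim/coset_ind=> x.
  by rewrite -cosetM !quo_xactE xactM.
- elim/coset_ind=> g; elim/coset_ind=> x; elim/coset_ind=> y.
  by rewrite -cosetM !quo_xactE xact_mul cosetM.
- elim/coset_ind=> g; elim/coset_ind=> x.
  by rewrite quo_xactE /= !quo_xdE xd_act !cosetM cosetV.
- elim/coset_ind=> x; elim/coset_ind=> y.
  by rewrite /= quo_xdE quo_xactE xact_d !cosetM cosetV.
Defined.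

End QuotientCrossedModule.

Section Center.
Variable G : crossedModule.

Definition fixed1 : {pred xm1 G} :=
  fun x => `[< forall g : xm0 G, xact g x = x >].

Definition stab_center0 : {pred xm0 G} :=
  fun g => `[< (forall x : xm1 G, xact g x = x) /\
               (forall h : xm0 G, g * h = h * g) >].

Lemma fixed1P x : reflect (forall g : xm0 G, xact g x = x) (x \in fixed1).
Proof. exact: asboolP. Qed.

Lemma stab_center0P g :
  reflect ((forall x : xm1 G, xact g x = x) /\
           (forall h : xm0 G, g * h = h * g)) (g \in stab_center0).
Proof. exact: asboolP. Qed.

Fact fixed1M : mulg_closed fixed1.
Proof.
by move=> x y /fixed1P fx /fixed1P fy; apply/fixed1P=> g; rewrite xact_mul fx fy.
Qed.
Fact fixed1_1 : 1 \in fixed1.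
Proof. by apply/fixed1P=> g; rewrite xact_one. Qed.
Fact fixed1V : invg_closed fixed1.
Proof. by move=> x /fixed1P fx; apply/fixed1P=> g; rewrite xact_inv fx. Qed.
HB.instance Definition _ := isMulClosed.Build (xm1 G) fixed1 fixed1M.
HB.instance Definition _ := isMul1Closed.Build (xm1 G) fixed1 fixed1_1.
HB.instance Definition _ := isInvClosed.Build (xm1 G) fixed1 fixed1V.

Fact stab_center0M : mulg_closed stab_center0.
Proof.
move=> g h /stab_center0P[ag cg] /stab_center0P[ah ch].
apply/stab_center0P; split=> [x|k]; first by rewrite xactM ah ag.
by rewrite -mulgA ch !mulgA cg.
Qed.
Fact stab_center0_1 : 1 \in stab_center0.
Proof.
by apply/stab_center0P; split=> [x|h]; rewrite ?xact1 // mul1g mulg1.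
Qed.
Fact stab_center0V : invg_closed stab_center0.
Proof.
move=> g /stab_center0P[ag cg]; apply/stab_center0P; split=> [x|h].
  by rewrite -[x in LHS]ag -xactM mulVg xact1.
by apply: (mulgI g); rewrite mulgA mulgV mul1g mulgA cg mulgK.
Qed.
HB.instance Definition _ :=
  isMulClosed.Build (xm0 G) stab_center0 stab_center0M.
HB.instance Definition _ :=
  isMul1Closed.Build (xm0 G) stab_center0 stab_center0_1.
HB.instance Definition _ :=
  isInvClosed.Build (xm0 G) stab_center0 stab_center0V.

Fact center_d x : x \in fixed1 -> xd G x \in stab_center0.
Proof.
move=> /fixed1P fx; apply/stab_center0P; split=> [y|h].
  have := fx (xd G y); rewrite !xact_d => xy.
  by rewrite -[x in x * y]xy mulgVK mulgK.
by rewrite -[in LHS](fx h) xd_act mulgVK.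
Qed.

Fact center_act g x : x \in fixed1 -> xact g x \in fixed1.
Proof. by move=> fx; rewrite (fixed1P _ fx). Qed.

Definition center_sub : subXmod G :=
  @SubXmod G fixed1 stab_center0 center_d (fun g x _ => @center_act g x).

Fact center0J (g n : xm0 G) :
  n \in stab_center0 -> g * n * g^-1 \in stab_center0.
Proof. by move=> nZ; have /stab_center0P[_ cn] := nZ; rewrite -cn mulgK. Qed.

Fact center0_act (n : xm0 G) (x : xm1 G) :
  n \in stab_center0 -> xact n x * x^-1 \in fixed1.
Proof. by move=> /stab_center0P[an _]; rewrite an mulgV fixed1_1. Qed.

Definition xmod_center : normalSubXmod G :=
  @NormalSubXmod G center_sub center0J center_act center0_act.

End Center.

Definition modZ (G : crossedModule) : crossedModule :=
  quotient_xmod (xmod_center G).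

Definition disp (G : crossedModule) (g : xm0 G) (x : xm1 G) : xm1 G :=
  xact g x * x^-1.

Section Commutator.
Variable G : crossedModule.

Definition displacement : groupClosed (xm1 G) :=
  generated (fun y : xm1 G => exists g x, y = disp g x).

Lemma mem_displacement g x : disp g x \in displacement.
Proof. by apply: mem_generated; exists g, x. Qed.

Fact xd_disp g x : xd G (disp g x) = comm g (xd G x).
Proof. by rewrite /disp gmulfM hom_inv xd_act. Qed.

Definition preim_derived : {pred xm1 G} :=
  fun x => xd G x \in derived (xm0 G).
Fact mem_preim_derived x :
  (x \in preim_derived) = (xd G x \in derived (xm0 G)).
Proof. by []. Qed.
Fact preim_derivedM : mulg_closed preim_derived.
Proof. by move=> x y xP yP; rewrite mem_preim_derived gmulfM; apply: gpredM. Qed.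
Fact preim_derived1 : 1 \in preim_derived.
Proof. by rewrite mem_preim_derived gmulf1; apply: gpred1. Qed.
Fact preim_derivedV : invg_closed preim_derived.
Proof. by move=> x xP; rewrite mem_preim_derived hom_inv gpredV. Qed.
HB.instance Definition _ :=
  isMulClosed.Build (xm1 G) preim_derived preim_derivedM.
HB.instance Definition _ :=
  isMul1Closed.Build (xm1 G) preim_derived preim_derived1.
HB.instance Definition _ :=
  isInvClosed.Build (xm1 G) preim_derived preim_derivedV.

Fact commutator_d x : x \in displacement -> xd G x \in derived (xm0 G).
Proof.
move=> /generatedP/(_ preim_derived); apply=> _ [g [y ->]].
by rewrite mem_preim_derived xd_disp; exact: mem_derived.
Qed.

Fact commutator_act (g : xm0 G) x :
  g \in derived (xm0 G) -> x \in displacement -> xact g x \in displacement.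
Proof.
move=> _ xD; rewrite -[xact g x](mulgVK x).
by apply: gpredM => //; exact: mem_displacement.
Qed.

Definition xmod_commutator : subXmod G :=
  @SubXmod G displacement (derived (xm0 G)) commutator_d commutator_act.

End Commutator.

Definition commX (G : crossedModule) : crossedModule :=
  xmod_of_sub (xmod_commutator G).

Section CommutatorMaps.
Variable G : crossedModule.

Definition bar1 (x : xm1 G) : xm1 (modZ G) := coset (nsub1 (xmod_center G)) x.
Definition bar0 (g : xm0 G) : xm0 (modZ G) := coset (nsub0 (xmod_center G)) g.

(* [c1] and [c0] are computed on chosen representatives; [c1E] and [c0E] show
   that the choice is irrelevant. *)
Definition c1 (p : xm1 (modZ G)) (q : xm0 (modZ G)) : xm1 (commX G) :=
  subgroup_elt (mem_displacement (repr q) (repr p)).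

Definition c0 (p q : xm0 (modZ G)) : xm0 (commX G) :=
  subgroup_elt (mem_derived (repr p) (repr q)).

Lemma c1E (x : xm1 G) (g : xm0 G) :
  c1 (bar1 x) (bar0 g) = subgroup_elt (mem_displacement g x).
Proof.
apply: val_inj => /=.
have [n /fixed1P nZ ->] := repr_coset (nsub1 (xmod_center G)) x.
have [m /stab_center0P[am _] ->] := repr_coset (nsub0 (xmod_center G)) g.
by rewrite /disp xactM am xact_mul nZ invgM mulgA mulgK.
Qed.

Lemma c0E (g h : xm0 G) :
  c0 (bar0 g) (bar0 h) = subgroup_elt (mem_derived g h).
Proof.
apply: val_inj => /=.
have [m /stab_center0P[_ cm] ->] := repr_coset (nsub0 (xmod_center G)) g.
have [n /stab_center0P[_ cn] ->] := repr_coset (nsub0 (xmod_center G)) h.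
rewrite /comm !invgM !mulgA; congr (_ * _).
have -> : g * m * h * n * m^-1 = g * h * n.
  by rewrite -(mulgA g m h) cm !mulgA -(mulgA _ m n) cm !mulgA mulgK.
by rewrite -(mulgA _ n g^-1) cn !mulgA mulgK.
Qed.

End CommutatorMaps.

Definition isoclinic (G H : crossedModule) : Prop :=
  exists (eta : xmodHom (modZ G) (modZ H)) (xi : xmodHom (commX G) (commX H)),
    [/\ is_xmod_iso eta, is_xmod_iso xi,
        forall p q, hom1 xi (c1 p q) = c1 (hom1 eta p) (hom0 eta q)
      & forall p q, hom0 xi (c0 p q) = c0 (hom0 eta p) (hom0 eta q)].

(* Main.v *)
From HB Require Import structures.
From mathcomp Require Import all_boot.
Require Import Defs.
From Corelib Require Import RelationClasses.

Set Implicit Arguments.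
Unset Strict Implicit.
Unset Printing Implicit Defensive.

(** An isoclinism from [G] to [H] is a pair of isomorphisms
    [eta : modZ G -> modZ H] and [xi : commX G -> commX H] intertwining the
    commutator maps [c1] and [c0].  Crossed modules form a category, so
    identities, composites and set-theoretic inverses of isomorphisms are
    isomorphisms.  The intertwining conditions say that two squares commute:
    they hold for identities, they can be pasted for composites, and a
    commuting square whose sides are invertible can be read backwards, which
    is symmetry. *)

Definition xmod_id (G : crossedModule) : xmodHom G G :=
  @XmodHom G G idfun idfun (fun _ => erefl) (fun _ _ => erefl).

Lemma xmod_id_iso (G : crossedModule) : is_xmod_iso (xmod_id G).
Proof. by split; exists idfun. Qed.

Section Composition.
Variables (G H K : crossedModule) (f : xmodHom H K) (e : xmodHom G H).

Fact xmod_comp_d x :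
  (hom0 f \o hom0 e) (xd G x) = xd K ((hom1 f \o hom1 e) x).
Proof. by rewrite /= !hom_d. Qed.

Fact xmod_comp_act g x :
  (hom1 f \o hom1 e) (xact g x) =
  xact ((hom0 f \o hom0 e) g) ((hom1 f \o hom1 e) x).
Proof. by rewrite /= !hom_act. Qed.

Definition xmod_comp : xmodHom G K :=
  @XmodHom G K (hom1 f \o hom1 e) (hom0 f \o hom0 e) xmod_comp_d xmod_comp_act.

Lemma xmod_comp_iso : is_xmod_iso f -> is_xmod_iso e -> is_xmod_iso xmod_comp.
Proof. by move=> [f1 f0] [e1 e0]; split; apply: bij_comp. Qed.

End Composition.

Lemma groupHom_inverse (A B : groupType) (f : groupHom A B) :
  bijective f -> exists2 g : groupHom B A, cancel f g & cancel g f.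
Proof.
case=> g fK gK.
have gM : monoid_morphism g.
  split=> [|x y]; apply: (can_inj fK); first by rewrite gK gmulf1.
  by rewrite gmulfM !gK.
pose mix := isUMagmaMorphism.Build B A g gM.
pose gh : groupHom B A := HB.pack g mix.
by exists gh.
Qed.

(** The inverse is recorded with its cancellation laws on both components,
    since reversing a commuting square needs them and not just its
    bijectivity. *)
Lemma xmod_iso_inverse (G H : crossedModule) (f : xmodHom G H) :
  is_xmod_iso f -> exists g : xmodHom H G,
    [/\ is_xmod_iso g, cancel (hom1 f) (hom1 g), cancel (hom1 g) (hom1 f),
        cancel (hom0 f) (hom0 g) & cancel (hom0 g) (hom0 f)].
Proof.
move=> [/groupHom_inverse[g1 f1K g1K] /groupHom_inverse[g0 f0K g0K]].
have gd x : g0 (xd H x) = xd G (g1 x).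
  by apply: (can_inj f0K); rewrite g0K hom_d g1K.
have ga h x : g1 (xact h x) = xact (g0 h) (g1 x).
  by apply: (can_inj f1K); rewrite g1K hom_act g1K g0K.
exists (XmodHom gd ga); split=> //.
by split; [exists (hom1 f) | exists (hom0 f)].
Qed.

Lemma isoclinic_refl (G : crossedModule) : isoclinic G G.
Proof.
by exists (xmod_id _), (xmod_id _); split=> //; apply: xmod_id_iso.
Qed.

Lemma isoclinic_sym (G H : crossedModule) : isoclinic G H -> isoclinic H G.
Proof.
move=> [eta [xi [eta_iso xi_iso sq1 sq0]]].
have [eta' [eta'_iso _ eta1K _ eta0K]] := xmod_iso_inverse eta_iso.
have [xi' [xi'_iso xi1K _ xi0K _]] := xmod_iso_inverse xi_iso.
exists eta', xi'; split=> // p q.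
  by rewrite -[in LHS](eta1K p) -[in LHS](eta0K q) -sq1 xi1K.
by rewrite -[in LHS](eta0K p) -[in LHS](eta0K q) -sq0 xi0K.
Qed.

Lemma isoclinic_trans (G H K : crossedModule) :
  isoclinic G H -> isoclinic H K -> isoclinic G K.
Proof.
move=> [eta [xi [eta_iso xi_iso sq1 sq0]]].
move=> [eta' [xi' [eta'_iso xi'_iso sq1' sq0']]].
exists (xmod_comp eta' eta), (xmod_comp xi' xi).
split; [exact: xmod_comp_iso | exact: xmod_comp_iso | |] => p q.
  by rewrite /= sq1 sq1'.
by rewrite /= sq0 sq0'.
Qed.

Theorem proposition19 : Equivalence isoclinic.
Proof.
split; [exact: isoclinic_refl | exact: isoclinic_sym | exact: isoclinic_trans].
Qed.
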